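(* No estimate of the form $$\int_{T^2}\mathbb V^\mu_x\,d\mu=\sum_{\alpha\in T^2:\ \mathbb V^\mu(\alpha)\le x}(\mathbb I^*\mu(\alpha))^2\le F(x)$$ can hold for all probability measures $\mu$ on bi-trees and all large $x$, whatever the function $F$. That is, for every $x_0\ge1$ and every function $F:[x_0,\infty)\to(0,\infty)$ there exist $N\ge1$, a measure $\mu$ on $T^2=T_N\times T_N$ with $|\mu|=1$, and $x\ge x_0$ such that $$\int_{T^2}\mathbb V^\mu_x\,d\mu>F(x).$$
   Context: For an integer $N\ge1$, $T=T_N$ denotes the finite rooted dyadic tree whose vertices are the dyadic subintervals of $[0,1]$ of length $2^{-k}$, $0\le k\le N$, ordered by inclusion. The bi-tree $T^2=T\times T$ has as vertices the dyadic rectangles $R=I\times J$ with $I,J\in T$, ordered by inclusion: $\alpha\le\alpha'$ iff the rectangle $\alpha$ is contained in the rectangle $\alpha'$. Its boundary $\partial T^2$ is the set of dyadic squares of size $2^{-N}\times2^{-N}$. For $f:T^2\to[0,\infty)$ put $\mathbb I f(\alpha)=\sum_{\alpha'\ge\alpha}f(\alpha')$ and $\mathbb I^* f(\alpha)=\sum_{\alpha'\le\alpha}f(\alpha')$. A measure on $T^2$ is a function $\mu:T^2\to[0,\infty)$ that vanishes outside $\partial T^2$; $|\mu|=\sum_{\alpha}\mu(\alpha)$ is its total mass and $\int_{T^2}u\,d\mu=\sum_\alpha u(\alpha)\mu(\alpha)$. Its potential is $\mathbb V^\mu=\mathbb I(\mathbb I^*\mu)$. For $x>0$, $\mathbb V^\mu_x=\mathbb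 I(\mathbf 1_{\{\mathbb V^\mu\le x\}}\,\mathbb I^*\mu)$. *)

(* Defs.v *)
From HB Require Import structures.
From mathcomp Require Import all_boot all_order all_algebra.
From mathcomp Require Import reals.

Set Implicit Arguments.
Unset Strict Implicit.
Unset Printing Implicit Defensive.

Import Order.TTheory GRing.Theory Num.Theory.
Local Open Scope ring_scope.

(* The pair of k <= N and j < 2 ^ k stands for [j / 2 ^ k, (j + 1) / 2 ^ k]. *)
Definition tree (N : nat) : finType := {k : 'I_N.+1 & 'I_(2 ^ k)%N}.

Definition dyadic_itv (N : nat) (I : tree N) : interval rat :=
  let k := nat_of_ord (tag I) in
  let j := nat_of_ord (tagged I) in
  `[j%:R / 2 ^+ k, j.+1%:R / 2 ^+ k].

Definition bitree (N : nat) : finType := (tree N * tree N)%type.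

(* The order of [interval rat] is inclusion; a rectangle is contained in
   another one iff its two sides are, since no side is empty. *)
Definition rect_le (N : nat) (a b : bitree N) : bool :=
  (dyadic_itv a.1 <= dyadic_itv b.1)%O && (dyadic_itv a.2 <= dyadic_itv b.2)%O.

Definition level (N : nat) (I : tree N) : nat := tag I.

Definition boundary (N : nat) : {set bitree N} :=
  [set a : bitree N | (level a.1 == N) && (level a.2 == N)].

Section Potential.
Variables (R : realType) (N : nat).
Implicit Types (f u mu : bitree N -> R) (a : bitree N) (x : R).

Definition hardy f a : R := \sum_(b | rect_le a b) f b.

Definition hardy_dual f a : R := \sum_(b | rect_le b a) f b.

Definition is_measure mu : Prop :=
  (forall a, 0 <= mu a) /\ (forall a, a \notin boundary N -> mu a = 0).

Definition mass mu : R := \sum_a mu a.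

Definition integral mu u : R := \sum_a u a * mu a.

Definition potential mu : bitree N -> R := hardy (hardy_dual mu).

Definition truncated_potential mu x : bitree N -> R :=
  hardy (fun a => (potential mu a <= x)%R%:R * hardy_dual mu a).

End Potential.

(* Main.v *)
Require Import Defs.
From HB Require Import structures.
From mathcomp Require Import all_boot all_order all_algebra.
From mathcomp Require Import reals.
From mathcomp Require Import zify ring lra.

Set Implicit Arguments.
Unset Strict Implicit.
Unset Printing Implicit Defensive.

Import Order.TTheory GRing.Theory Num.Theory.
Local Open Scope ring_scope.

(** The identity is an exchange of sums.  For the divergence, fix x
at least 20 and place 2^n atoms of mass 2^-n on the diagonal of the square, at
the grid points p / 2^n, with N = 2^n much larger than n.

A rectangle of levels (a, b) meets the diagonal only in an interval of length
2^-max(a,b), hence has measure at most 2 / 2^n + 2^-max(a,b)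
([hardy_dual_diag_le]).  The second term is summable over all pairs of levels,
so that the potential of a rectangle of levels (a, b) is at most
2 (a + 1) (b + 1) / 2^n + 16 ([potential_diag_le]): the large ancestors have a
bounded contribution, and the small ones carry the mass of an atom or two.

Consequently, at each atom the rectangles whose levels lie in the hyperbolic
region n <= a, n <= b, (a + 1) (b + 1) <= 2^(n+1) all have potential at most
20, and each has measure at least 2^-n.  Up to the factor 2^-n
and constants, the potential of such a rectangle counts the pairs of levels up
to (a, b), at most 2^(n+1) of them, whereas the truncated potential at the atom
counts all pairs in the region, of which there are at least a constant times
n 2^n ([hyperbolic_card_ge]).  So the truncated potential is at least a constant
times n at every atom ([truncated_potential_diag_ge]), while x stays fixed. *)

(** * Dyadic intervals and their ancestors *)

Definition position (N : nat) (I : tree N) : nat := tagged I.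

(** Clearing denominators turns the inclusion of dyadic intervals into a
statement about natural numbers. *)
Lemma dyadic_itv_leE (N : nat) (I J : tree N) :
  (dyadic_itv I <= dyadic_itv J)%O =
  ((position J * 2 ^ level I <= position I * 2 ^ level J)%N &&
   ((position I).+1 * 2 ^ level J <= (position J).+1 * 2 ^ level I)%N).
Proof.
rewrite /dyadic_itv -/(level I) -/(level J) -/(position I) -/(position J).
rewrite subitvE !bnd_simp.
have pos k : 0 < (2 : rat) ^+ k by rewrite exprn_gt0.
rewrite !ler_pdivrMr // !(mulrAC _ (_^-1)) !ler_pdivlMr //.
by rewrite -!natrX -!natrM !ler_nat.
Qed.

(** The sum of the two endpoint inequalities compares the lengths. *)
Lemma level_anti (N : nat) (I J : tree N) :
  (dyadic_itv I <= dyadic_itv J)%O -> (level J <= level I)%N.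
Proof.
rewrite dyadic_itv_leE !mulSn => /andP[le1 le2].
by rewrite -(leq_exp2l _ _ (isT : 1 < 2)%N); lia.
Qed.

Lemma tree_eq (N : nat) (I J : tree N) :
  level I = level J -> position I = position J -> I = J.
Proof.
case: I J => [k i] [l j]; rewrite /level /position /= => /val_inj ekl.
by case: _ / ekl j => j /val_inj ->.
Qed.

Lemma ancestor_uniq (N : nat) (I J K : tree N) :
  (dyadic_itv I <= dyadic_itv J)%O -> (dyadic_itv I <= dyadic_itv K)%O ->
  level J = level K -> J = K.
Proof.
rewrite !dyadic_itv_leE => /andP[J1 J2] /andP[K1 K2] eJK.
apply: tree_eq => //; move: J1 J2 K1 K2; rewrite eJK.
have := expn_gt0 2 (level K); have := expn_gt0 2 (level I).
by move: (2 ^ _)%N (2 ^ _)%N => u v; nia.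
Qed.

Section Ancestors.
Variables (R : realType) (N : nat).
Implicit Types (I J : tree N) (g : nat -> R).

(** An interval has at most one ancestor of each level, so a sum of a function
of the level over the ancestors is at most a sum over the levels. *)
Lemma sum_ancestors_le I g (g_ge0 : forall c, 0 <= g c) :
  \sum_(J : tree N | (dyadic_itv I <= dyadic_itv J)%O) g (level J) <=
  \sum_(c < (level I).+1) g c.
Proof.
pose A := [set J : tree N | (dyadic_itv I <= dyadic_itv J)%O].
pose h (J : tree N) : 'I_(level I).+1 := inord (level J).
have hE J : J \in A -> h J = level J :> nat.
  by rewrite inE => /level_anti le_JI; rewrite /h inordK ?ltnS.
have h_inj : {in A &, injective h}.
  move=> J K JA KA /(congr1 val) /=; rewrite !hE //.
  by move: JA KA; rewrite !inE; apply: ancestor_uniq.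
rewrite (eq_bigl (fun J => J \in A)) => [|J]; last by rewrite inE.
rewrite (eq_bigr (fun J => g (h J))) => [|J /hE -> //].
rewrite -(big_imset (fun c : 'I__ => g c) h_inj) /=.
by rewrite [leRHS](bigID (mem (h @: A))) /= lerDl sumr_ge0.
Qed.

Lemma sum_rect_ancestors_le (a : bitree N) g1 g2
    (g1_ge0 : forall c, 0 <= g1 c) (g2_ge0 : forall c, 0 <= g2 c) :
  hardy (fun b : bitree N => g1 (level b.1) * g2 (level b.2)) a <=
  (\sum_(c < (level a.1).+1) g1 c) * (\sum_(c < (level a.2).+1) g2 c).
Proof.
rewrite /hardy /rect_le.
rewrite -(pair_big (fun J => (dyadic_itv a.1 <= dyadic_itv J)%O)
  (fun J => (dyadic_itv a.2 <= dyadic_itv J)%O)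
  (fun J K : tree N => g1 (level J) * g2 (level K))) /=.
rewrite -big_distrlr /=.
by apply: ler_pM; rewrite ?sumr_ge0 // sum_ancestors_le.
Qed.

End Ancestors.

(** * A geometric sum and an exchange of sums *)

Lemma sum_geometric_le4 (R : realType) (m : nat) :
  \sum_(c < m) (3 / 4 : R) ^+ c <= 4.
Proof.
have : \sum_(c < m) (3 / 4 : R) ^+ c = 4 - 4 * (3 / 4) ^+ m.
  elim: m => [|m IH]; first by rewrite big_ord0 expr0; lra.
  by rewrite big_ord_recr /= IH exprS; lra.
move=> ->; have : 0 <= (3 / 4 : R) ^+ m by apply: exprn_ge0; lra.
lra.
Qed.

Lemma integral_truncated_potential (R : realType) (N : nat)
    (mu : bitree N -> R) (x : R) :
  integral mu (truncated_potential mu x) =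
  \sum_(a | potential mu a <= x) hardy_dual mu a ^+ 2.
Proof.
rewrite /integral /truncated_potential /hardy.
under eq_bigr do rewrite mulr_suml.
rewrite (exchange_big_dep xpredT) //= [RHS]big_mkcond.
apply: eq_bigr => b _; rewrite -mulr_sumr -/(hardy_dual mu b).
by case: ifP => _; rewrite ?mul1r ?mul0r.
Qed.

(** * Equal point masses on the diagonal *)

Fact grid_position_lt (n a : nat) (p : 'I_(2 ^ n)) :
  (p * 2 ^ a %/ 2 ^ n < 2 ^ a)%N.
Proof. by rewrite ltn_divLR ?expn_gt0 // mulnC ltn_pmul2l ?expn_gt0. Qed.

Section Diagonal.
Variables (R : realType) (N n : nat).
Hypothesis le_nN : (n <= N)%N.

(** The interval of level [a] that contains p / 2^n, as its left endpoint when
[n <= a]: its position is the integer part of 2^a p / 2^n. *)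
Definition grid_itv (p : 'I_(2 ^ n)) (a : 'I_N.+1) : tree N :=
  Tagged (fun k : 'I_N.+1 => 'I_(2 ^ k)) (Ordinal (grid_position_lt a p)).

Definition diag (p : 'I_(2 ^ n)) : bitree N :=
  (grid_itv p ord_max, grid_itv p ord_max).

Definition diag_measure (b : bitree N) : R :=
  \sum_(p < 2 ^ n) (b == diag p)%:R / 2 ^+ n.

Lemma level_grid p a : level (grid_itv p a) = a.
Proof. by []. Qed.

Lemma position_grid p (a : 'I_N.+1) :
  (n <= a)%N -> position (grid_itv p a) = (p * 2 ^ (a - n))%N.
Proof.
by move=> le_na; rewrite /position /= -{1}(subnK le_na) expnD mulnA mulnK ?expn_gt0.
Qed.

Lemma grid_le p (a : 'I_N.+1) : (n <= a)%N ->
  (dyadic_itv (grid_itv p ord_max) <= dyadic_itv (grid_itv p a))%O.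
Proof.
move=> le_na; rewrite dyadic_itv_leE !level_grid !position_grid //=.
have le_aN : (a <= N)%N by rewrite -ltnS.
have e : (2 ^ (a - n) * 2 ^ N = 2 ^ (N - n) * 2 ^ a)%N.
  by rewrite -!expnD; congr expn; lia.
rewrite -!mulnA e leqnn /= !mulSn -!mulnA e leq_add2r.
by rewrite leq_exp2l.
Qed.

(** Integrating against the diagonal measure is averaging over the atoms. *)
Lemma integral_diag (u : bitree N -> R) :
  integral diag_measure u = (\sum_(p < 2 ^ n) u (diag p)) / 2 ^+ n.
Proof.
rewrite /integral /diag_measure.
under eq_bigr do rewrite mulr_sumr.
rewrite exchange_big /= mulr_suml; apply: eq_bigr => p _.
rewrite (bigD1 (diag p)) //= eqxx big1 ?addr0 ?mul1r // => b /negPf ->.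
by rewrite mul0r mulr0.
Qed.

Lemma diag_measureP : is_measure diag_measure.
Proof.
split=> [a|a a_notin]; first by apply: sumr_ge0 => p _; rewrite divr_ge0 ?exprn_ge0.
rewrite /diag_measure big1 // => p _; case: eqP => [ea|_]; last by rewrite mul0r.
by move: a_notin; rewrite ea inE /= eqxx.
Qed.

Lemma mass_diag : mass diag_measure = 1.
Proof.
have -> : mass diag_measure = integral diag_measure (fun=> 1).
  by apply: eq_bigr => b _; rewrite mul1r.
rewrite integral_diag sumr_const card_ord natrX divff //.
by rewrite expf_neq0 // pnatr_eq0.
Qed.

Lemma hardy_dual_diag (b : bitree N) :
  hardy_dual diag_measure b = #|[set p | rect_le (diag p) b]|%:R / 2 ^+ n.
Proof.
have -> : hardy_dual diag_measure b =
    integral diag_measure (fun a => (rect_le a b)%:R).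
  rewrite /hardy_dual big_mkcond; apply: eq_bigr => a _.
  by case: ifP => _; rewrite ?mul1r ?mul0r.
rewrite integral_diag -sum1_card natr_sum [in RHS]big_mkcond /=.
by congr (_ / _); apply: eq_bigr => p _; rewrite inE; case: ifP.
Qed.

Lemma hardy_dual_ge0 (b : bitree N) : 0 <= hardy_dual diag_measure b.
Proof. by rewrite hardy_dual_diag divr_ge0 ?exprn_ge0. Qed.

(** The grid points in an interval of level c are consecutive multiples of
2^-n within a distance less than 2^-c, so there are at most
max(1, 2^(n-c)) of them; the sum is a bound that covers both cases. *)
Lemma card_grid_le (J : tree N) :
  (#|[set p | (dyadic_itv (grid_itv p ord_max) <= dyadic_itv J)%O]|
     <= 1 + 2 ^ (n - level J))%N.
Proof.
set A := [set _ | _]; set m := (2 ^ (n - level J))%N.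
have bounds p : p \in A ->
    (position J * 2 ^ n <= p * 2 ^ level J < (position J).+1 * 2 ^ n)%N.
  rewrite inE dyadic_itv_leE !level_grid position_grid //=.
  have -> : (2 ^ N = 2 ^ (N - n) * 2 ^ n)%N by rewrite -expnD subnK.
  have := expn_gt0 2 (level J); have := expn_gt0 2 (N - n).
  move: (2 ^ (N - n))%N (2 ^ level J)%N (2 ^ n)%N (position J) (nat_of_ord p).
  by move=> u v w i k; nia.
(* Two grid points of [J] differ by fewer than [m] steps of the grid. *)
have close p q : p \in A -> q \in A -> (p < q + m)%N.
  move=> /bounds/andP[_ p2] /bounds/andP[q1 _].
  have le_m : (2 ^ n <= m * 2 ^ level J)%N.
    by rewrite /m -expnD leq_exp2l //; lia.
  have lt : (p * 2 ^ level J < (q + m) * 2 ^ level J)%N.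
    by rewrite mulnDl; move: p2; rewrite mulSn; lia.
  by rewrite ltn_pmul2r ?expn_gt0 in lt.
have [->|[q0 q0A]] := set_0Vmem A; first by rewrite cards0.
(* Subtracting the least of them sends them injectively into [0, m]. *)
case: (@arg_minnP _ q0 (mem A) (fun p : 'I__ => val p) q0A) => q qA q_min.
rewrite -[X in (_ <= X)%N](card_ord (1 + m)).
have inj : {in A &, injective (fun p : 'I__ => inord (p - q) : 'I_(1 + m))}.
  move=> p p' pA p'A /(congr1 val) /=.
  have := close _ _ pA qA; have := close _ _ p'A qA.
  have := q_min _ pA; have := q_min _ p'A => /= l1 l2 l3 l4.
  by rewrite !inordK; try lia; move=> e; apply: val_inj => /=; lia.
by rewrite -(card_in_imset inj) max_card.
Qed.

(** An atom lies in the rectangle only if it lies in its thinner side, whence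
the bound 2 / 2^n + 2^-max(a,b) for levels a and b.  As 1/2 <= (3/4)^2, the
term 2^-max(a,b) is at most (3/4)^(a+b), which is a product of functions of
each level, as [sum_rect_ancestors_le] requires. *)
Lemma hardy_dual_diag_le (b : bitree N) :
  hardy_dual diag_measure b <=
  2 / 2 ^+ n + (3 / 4) ^+ level b.1 * (3 / 4) ^+ level b.2.
Proof.
pose c := maxn (level b.1) (level b.2).
have half : hardy_dual diag_measure b <= (1 + (2 ^ (n - c))%:R) / 2 ^+ n.
  rewrite hardy_dual_diag ler_pM2r ?invr_gt0 ?exprn_gt0 //.
  rewrite (_ : 1 = 1%:R :> R) // -natrD ler_nat.
  rewrite /c; case: (leqP (level b.1)) => _; apply: leq_trans (card_grid_le _);
    by apply/subset_leq_card/subsetP=> p; rewrite !inE => /andP[].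
apply: (le_trans half).
have pow_gt0 : 0 < (2 : R) ^+ n by rewrite exprn_gt0.
rewrite -exprD -(ler_pM2r pow_gt0) divfK ?gt_eqF // mulrDl divfK ?gt_eqF // natrX.
have tail_ge0 : 0 <= (3 / 4 : R) ^+ (level b.1 + level b.2).
  by apply: exprn_ge0; lra.
case: (leqP c n) => [le_cn|/ltnW lt_nc]; last first.
  by rewrite (eqP lt_nc) expr0; nra.
have decay : 2^-1 ^+ c <= (3 / 4 : R) ^+ (level b.1 + level b.2).
  apply: (@le_trans _ _ ((3 / 4) ^+ (2 * c))).
    by rewrite exprM; apply: lerXn2r; rewrite ?nnegrE; lra.
  by apply: ler_wiXn2l; [lra | lra | rewrite /c; lia].
have -> : (2 : R) ^+ (n - c) = 2^-1 ^+ c * 2 ^+ n.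
  by rewrite -[in RHS](subnKC le_cn) exprD mulrA -exprMn mulVf ?pnatr_eq0 // expr1n mul1r.
nra.
Qed.

(** Summed over the ancestors, the two terms of [hardy_dual_diag_le] give the
number of pairs of levels and the product of two geometric series. *)
Lemma potential_diag_le (a : bitree N) :
  potential diag_measure a <=
  2 * ((level a.1).+1 * (level a.2).+1)%:R / 2 ^+ n + 16.
Proof.
have s0 c : 0 <= (3 / 4 : R) ^+ c by apply: exprn_ge0; lra.
pose v : R := 2 / 2 ^+ n.
have v_ge0 : 0 <= v by rewrite divr_ge0 ?exprn_ge0.
have le1 := sum_rect_ancestors_le a (fun=> v_ge0) (fun=> ler01).
have le2 := sum_rect_ancestors_le a s0 s0.
have le3 : potential diag_measure a <= hardy (fun=> v * 1) a +
    hardy (fun b : bitree N => (3 / 4) ^+ level b.1 * (3 / 4) ^+ level b.2) a.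
  rewrite /potential /hardy -big_split /=; apply: ler_sum => b _.
  by rewrite mulr1 hardy_dual_diag_le.
apply: (le_trans le3); apply: lerD.
  apply: (le_trans le1); rewrite !sumr_const !card_ord.
  by rewrite natrM -(mulr_natr v) /v; lra.
apply: (le_trans le2).
rewrite (_ : 16 = 4 * 4); last by ring.
by apply: ler_pM; rewrite ?sum_geometric_le4 // sumr_ge0.
Qed.

(** Pairs of levels at which the rectangles around an atom are too small to
meet the diagonal grid elsewhere but still have bounded potential. *)
Definition hyperbolic (a b : nat) : bool :=
  [&& n <= a, n <= b & a.+1 * b.+1 <= 2 ^ n.+1]%N.

(** For a fixed atom, the rectangles around it are determined by their levels;
those with hyperbolic levels survive the truncation, since their potential is
at most 2 * 2 + 16, and each contributes the mass 2^-n of the atom at least. *)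
Lemma truncated_potential_diag_ge (x : R) (p : 'I_(2 ^ n)) : 20 <= x ->
  (\sum_(a < N.+1) \sum_(b < N.+1) hyperbolic a b)%:R / 2 ^+ n <=
  truncated_potential diag_measure x (diag p).
Proof.
move=> x_ge20.
pose G := [set ab : 'I_N.+1 * 'I_N.+1 | hyperbolic ab.1 ab.2].
pose rect (ab : 'I_N.+1 * 'I_N.+1) : bitree N :=
  (grid_itv p ab.1, grid_itv p ab.2).
have rect_inj : injective rect by move=> [a b] [a' b'] [-> _ -> _].
have -> : (\sum_(a < N.+1) \sum_(b < N.+1) hyperbolic a b)%N = #|G|.
  rewrite pair_bigA /= -sum1_card [RHS]big_mkcond.
  by apply: eq_bigr => ab _; rewrite inE; case: ifP.
have above ab : ab \in G -> rect_le (diag p) (rect ab).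
  by rewrite inE => /and3P[le1 le2 _]; rewrite /rect_le !grid_le.
have below ab : ab \in G -> potential diag_measure (rect ab) <= x.
  rewrite inE => /and3P[_ _ le_ab].
  apply: le_trans (potential_diag_le _) _; rewrite /= !level_grid.
  have : (ab.1.+1 * ab.2.+1)%:R / 2 ^+ n <= 2 :> R.
    rewrite ler_pdivrMr ?exprn_gt0 // -exprS -natrX ler_nat //.
  lra.
have heavy ab : ab \in G -> 1 / 2 ^+ n <= hardy_dual diag_measure (rect ab).
  move=> /above p_ab; rewrite hardy_dual_diag ler_pM2r ?invr_gt0 ?exprn_gt0 //.
  by rewrite ler1n card_gt0; apply/set0Pn; exists p; rewrite inE.
rewrite /truncated_potential /hardy (bigID (mem (rect @: G))) /=.
rewrite -[leLHS]addr0 lerD //; last first.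
  by apply: sumr_ge0 => b _; rewrite mulr_ge0 ?hardy_dual_ge0.
rewrite (eq_bigl (fun b => b \in rect @: G)) => [|b]; last first.
  by rewrite andb_idl //= => /imsetP[ab abG ->]; exact: above.
rewrite big_imset /=; last by move=> ? ? _ _; apply: rect_inj.
rewrite -sum1_card natr_sum mulr_suml; apply: ler_sum => ab abG.
by rewrite below // [leRHS]mul1r; exact: heavy.
Qed.

Lemma integral_diag_ge (x : R) : 20 <= x ->
  (\sum_(a < N.+1) \sum_(b < N.+1) hyperbolic a b)%:R / 2 ^+ n <=
  integral diag_measure (truncated_potential diag_measure x).
Proof.
move=> x_ge20; rewrite integral_diag.
set c : R := leLHS; have -> : c = (\sum_(p < 2 ^ n) c) / 2 ^+ n.
  rewrite sumr_const card_ord -(mulr_natr c) natrX mulfK //.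
  by rewrite expf_neq0 // pnatr_eq0.
rewrite ler_pM2r ?invr_gt0 ?exprn_gt0 //; apply: ler_sum => p _.
exact: truncated_potential_diag_ge.
Qed.

End Diagonal.

(** * Counting lattice points in the hyperbolic region *)

(** The condensation argument behind the divergence of the harmonic series:
each dyadic block contributes at least [C]. *)
Lemma sum_dyadic_blocks (g : nat -> nat) (C r m : nat) :
    (forall k a, r <= k < r + m -> 2 ^ k <= a < 2 ^ k.+1 -> C <= 2 ^ k * g a)%N ->
  (m * C <= \sum_(2 ^ r <= a < 2 ^ (r + m)) g a)%N.
Proof.
elim: m => [|m IH] blocks; first by rewrite mul0n.
rewrite (@big_cat_nat _ _ _ (2 ^ (r + m))) /= ?leq_exp2l //; try lia.
rewrite mulSn addnC leq_add //.
  by apply: IH => k a k_lt; apply: blocks; lia.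
rewrite -(leq_pmul2l (expn_gt0 2 (r + m))) big_distrr /= addnS.
rewrite (_ : 2 ^ (r + m) * C = \sum_(2 ^ (r + m) <= a < 2 ^ (r + m).+1) C)%N.
  rewrite big_nat_cond [leqRHS]big_nat_cond; apply: leq_sum => a.
  by rewrite andbT => a_in; apply: blocks => //; lia.
by rewrite sum_nat_const_nat expnS mul2n -addnn addnK.
Qed.

(** For 2^k <= a < 2^(k+1), every b with 2^(n-k-1) <= b < 2^(n-k) satisfies
(a + 1) (b + 1) <= 2^(n+1).  Taking n = 3 r and r <= k < 2 r, both exponents k
and n-k-1 are at least r, so that a and b are at least n.  Each of the r
blocks then has 2^k 2^(n-k-1) = 2^(n-1) points. *)
Lemma hyperbolic_card_ge (r : nat) : (3 * r <= 2 ^ r)%N ->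
  (r * 2 ^ (3 * r).-1 <= \sum_(a < (2 ^ (3 * r)).+1)
     \sum_(b < (2 ^ (3 * r)).+1) hyperbolic (3 * r) a b)%N.
Proof.
move=> r_small; set n := (3 * r)%N in r_small *; set N := (2 ^ n)%N.
pose g a := (\sum_(b < N.+1) hyperbolic n a b)%N.
have widen u v f : (u <= v -> v <= N.+1 ->
    \sum_(u <= a < v) f a <= \sum_(a < N.+1) f a)%N.
  move=> le_uv le_vN; rewrite -(big_mkord xpredT f).
  rewrite [leqRHS](@big_cat_nat _ _ _ u) ?(leq_trans le_uv) //=.
  by rewrite [X in (_ <= _ + X)%N](@big_cat_nat _ _ _ v) //= addnCA leq_addr.
apply: (@leq_trans (\sum_(2 ^ r <= a < 2 ^ (r + r)) g a)); last first.
  by apply: (widen _ _ g); rewrite ?leqW // leq_exp2l // /n; lia.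
apply: sum_dyadic_blocks => k a /andP[le_rk lt_k] /andP[a_ge a_lt].
have -> : (2 ^ n.-1 = 2 ^ k * 2 ^ (n - k.+1))%N.
  by rewrite -expnD; congr expn; rewrite /n; lia.
rewrite leq_pmul2l ?expn_gt0 //.
apply: (@leq_trans (\sum_(2 ^ (n - k.+1) <= b < 2 ^ (n - k)) hyperbolic n a b)).
  rewrite (_ : n - k = (n - k.+1).+1)%N; last by rewrite /n; lia.
  set l := (n - k.+1)%N.
  rewrite -[leqLHS](_ : \sum_(2 ^ l <= b < 2 ^ l.+1) 1 = 2 ^ l)%N; last first.
    by rewrite sum_nat_const_nat muln1 expnS mul2n -addnn addnK.
  rewrite big_nat_cond [leqRHS]big_nat_cond; apply: leq_sum => b.
  rewrite andbT => /andP[b_ge b_lt]; rewrite lt0b; apply/and3P; split.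
  - by rewrite (leq_trans r_small) // (leq_trans _ a_ge) // leq_exp2l.
  - rewrite (leq_trans r_small) // (leq_trans _ b_ge) // leq_exp2l //.
    by rewrite /l /n; lia.
  - have -> : n.+1 = (k.+1 + l.+1)%N by rewrite /l /n; lia.
    by rewrite expnD leq_mul.
by apply: widen; rewrite ?leqW // leq_exp2l //; lia.
Qed.

Theorem mainTheorem4 (R : realType) :
  (forall (N : nat) (mu : bitree N -> R) (x : R),
      (1 <= N)%N -> is_measure mu -> 0 < x ->
      integral mu (truncated_potential mu x) =
      \sum_(a | potential mu a <= x) hardy_dual mu a ^+ 2) /\
  (forall (x0 : R) (F : R -> R),
      1 <= x0 -> (forall x : R, x0 <= x -> 0 < F x) ->
      exists (N : nat) (mu : bitree N -> R) (x : R),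
        [/\ (1 <= N)%N, is_measure mu, mass mu = 1, x0 <= x &
            F x < integral mu (truncated_potential mu x)]).
Proof.
split=> [N mu x _ _ _|x0 F x0_ge1 F_gt0]; first exact: integral_truncated_potential.
pose x := x0 + 20.
have x_ge : x0 <= x by rewrite lerDl.
(* The integral is at least r / 2, and 3 r <= 2^r holds from 4 on. *)
pose r := (4 + 2 * Num.bound (F x))%N.
have r_small : (3 * r <= 2 ^ r)%N.
  rewrite /r; elim: (2 * _)%N => // m IH.
  by rewrite addnS expnS; lia.
pose n := (3 * r)%N.
have le_nN : (n <= 2 ^ n)%N by rewrite ltnW // ltn_expl.
exists (2 ^ n)%N, (@diag_measure R (2 ^ n) n), x; split=> //.
- by rewrite expn_gt0.
- exact: diag_measureP.
- exact: mass_diag.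
apply: lt_le_trans (integral_diag_ge le_nN _); last by rewrite /x; lra.
rewrite ltr_pdivlMr ?exprn_gt0 //.
apply: (@lt_le_trans _ _ (r * 2 ^ n.-1)%:R); last first.
  by rewrite ler_nat hyperbolic_card_ge.
have -> : n = n.-1.+1 by rewrite /n /r; lia.
rewrite /= exprS mulrA natrM natrX ltr_pM2r ?exprn_gt0 //.
have := archi_boundP (ltW (F_gt0 _ x_ge)).
rewrite /r natrD natrM; lra.
Qed.
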